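(* Let $\underline{T}:\mathbb{R}^{\mathcal{X}}\to\mathbb{R}^{\mathcal{X}}$ be a map that satisfies the coherence conditions C1, C2, C3 and the reachability condition R1 (listed in the context), and let $\mathcal{T}$ be its dual representation. Suppose that $\mathcal{T}$ has a finite number $m\in\mathbb{N}$ of extreme points. Let $\{h_n\}_{n\in\mathbb{N}}$ be any sequence in $\mathbb{R}^{\mathcal{X}}$ constructed as follows: $T_1$ is any extreme point of $\mathcal{T}$ and, for all $n\in\mathbb{N}$, $h_n$ is the unique solution in $\mathbb{R}^{\mathcal{X}}$ of the linear system $h_n=\mathbb{I}_{A^c}+\mathbb{I}_{A^c}\cdot T_nh_n$, and $T_{n+1}$ is an extreme point of $\mathcal{T}$ such that $\underline{T}h_n=T_{n+1}h_n$. Then there is some $n\leq m$ such that $h_k=h_*=\lim_{\ell\to+\infty}h_\ell$ for all $k\geq n$.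
   Context: $\mathcal{X}$ is a non-empty finite set, $A$ is a non-empty strict subset of $\mathcal{X}$, and $A^c = \mathcal{X}\setminus A$. $\mathbb{R}^{\mathcal{X}}$ is the set of all maps from $\mathcal{X}$ to $\mathbb{R}$; inequalities between such maps are pointwise, a constant is identified with the corresponding constant map, and $\cdot$ denotes pointwise multiplication. For $B\subseteq\mathcal{X}$, $\mathbb{I}_B\in\mathbb{R}^{\mathcal{X}}$ is the indicator of $B$. $\mathbb{N}$ does not contain $0$, and $M^n$ denotes the $n$-fold composition of a map $M$ with itself. Coherence conditions for a (possibly non-linear) map $\underline{T}:\mathbb{R}^{\mathcal{X}}\to\mathbb{R}^{\mathcal{X}}$: C1: $\underline{T}(\alpha f)=\alpha\underline{T}f$ for all $f\in\mathbb{R}^{\mathcal{X}}$ and all real $\alpha\geq 0$; C2: $\underline{T}f+\underline{T}g\leq\underline{T}(f+g)$ for all $f,g\in\mathbb{R}^{\mathcal{X}}$; C3: $\min_{x\in\mathcal{X}}f(x)\leq\underline{T}f$ for all $f\in\mathbb{R}^{\mathcal{X}}$. Reachability condition R1: for all $x\in A^c$ there is some $n_x\in\mathbb{N}$ such that $[\underline{T}^{n_x}\mathbb{I}_A](x)>0$. Separately specified rows: for a map $T:\mathbb{R}^{\mathcal{X}}\to\mathbb{R}^{\mathcal{X}}$ and $x\in\mathcal{X}$, let $T_x:\mathbb{R}^{\mathcal{X}}\to\mathbb{R}$, $f\mapsto[Tf](x)$. A set $\mathcal{T}$ of maps from $\mathbb{R}^{\mathcal{X}}$ to $\mathbb{R}^{\mathcal{X}}$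 has separately specified rows if $\mathcal{T}=\{T:\mathbb{R}^{\mathcal{X}}\to\mathbb{R}^{\mathcal{X}}\mid T_x\in\mathcal{T}_x\text{ for all }x\in\mathcal{X}\}$, where $\mathcal{T}_x=\{T_x\mid T\in\mathcal{T}\}$. Dual representation: for $\underline{T}$ satisfying C1, C2, C3, its dual representation $\mathcal{T}$ is the unique non-empty, closed and convex set with separately specified rows such that each $T\in\mathcal{T}$ is a linear map from $\mathbb{R}^{\mathcal{X}}$ to $\mathbb{R}^{\mathcal{X}}$ satisfying C1, C2, C3 (i.e. a row-stochastic $|\mathcal{X}|\times|\mathcal{X}|$ matrix), and such that $\underline{T}f=\inf_{T\in\mathcal{T}}Tf$ (pointwise infimum) for all $f\in\mathbb{R}^{\mathcal{X}}$. It is known that $\mathcal{T}$ has extreme points and that for every $f\in\mathbb{R}^{\mathcal{X}}$ there is an extreme point $T$ of $\mathcal{T}$ with $\underline{T}f=Tf$. Under R1, for each $T\in\mathcal{T}$ the system $h=\mathbb{I}_{A^c}+\mathbb{I}_{A^c}\cdot Th$ has a unique solution in $\mathbb{R}^{\mathcal{X}}$, and the limit of any sequence constructed as in the claim exists in $\mathbb{R}^{\mathcal{X}}$. *)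

(* Defs.v *)
From HB Require Import structures.
From mathcomp Require Import all_boot all_order all_algebra.
From mathcomp Require Import all_classical all_reals all_analysis.

Set Implicit Arguments.
Unset Strict Implicit.
Unset Printing Implicit Defensive.

Import Order.TTheory GRing.Theory Num.Theory numFieldNormedType.Exports.

Local Open Scope classical_set_scope.
Local Open Scope ring_scope.
Local Open Scope convex_scope.

Section ExtremePoints.
Context (R : numDomainType) (M : lmodType R).

Definition extreme_points (C : set (convex_lmodType M)) : set M :=
  [set x | C x /\
    forall (a b : convex_lmodType M) (t : {i01 R}), C a -> C b ->
      0 < t%:num < 1 -> x = a <| t |> b -> a = x /\ b = x].

End ExtremePoints.

Section ImpreciseChains.
Context (R : realType) (X : finType).
Implicit Types (T Tlow : (X -> R) -> X -> R) (TT : set ((X -> R) -> X -> R)).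

Definition coherence1 T :=
  forall (f : X -> R) (alpha : R), 0 <= alpha -> T (alpha *: f) = alpha *: T f.

Definition coherence2 T :=
  forall (f g : X -> R) (x : X), (T f + T g) x <= T (f + g) x.

(* The default value f x is itself a value of f, so the iterated minimum is
   exactly the minimum of f over X. *)
Definition coherence3 T :=
  forall (f : X -> R) (x : X), \big[Num.min/f x]_(y : X) f y <= T f x.

Definition coherent T := [/\ coherence1 T, coherence2 T & coherence3 T].

Definition reachability (A : set X) Tlow :=
  forall x, (~` A) x ->
    exists2 n : nat, (0 < n)%N & 0 < iter n Tlow (\1_A : X -> R) x.

Definition map_row T (x : X) : (X -> R) -> R := fun f => T f x.

Definition row_set TT (x : X) : set ((X -> R) -> R) :=
  [set map_row T x | T in TT].

Definition separately_specified_rows TT :=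
  TT = [set T | forall x, row_set TT x (map_row T x)].

(* Closedness is with respect to the topology of pointwise convergence; on
   linear maps of the finite-dimensional space X -> R (which form a
   pointwise-closed set) it is the topology of any norm. *)
Definition closed_maps TT :=
  closed (TT : set {ptws (X -> R) -> {ptws X -> R}}).

Definition is_dual_representation Tlow TT :=
  [/\ TT !=set0 /\ separately_specified_rows TT,
      closed_maps TT, convex_set TT,
      (forall T, TT T -> linear T /\ coherent T) &
      forall (f : X -> R) (x : X), Tlow f x = inf [set T f x | T in TT]].

Definition solves_hitting_system (A : set X) T (h : X -> R) :=
  h = \1_(~` A) + \1_(~` A) * T h.

End ImpreciseChains.

(* Main.v *)
Require Import Defs.
From HB Require Import structures.
From mathcomp Require Import all_boot all_order all_algebra.
From mathcomp Require Import all_classical all_reals all_analysis.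
From mathcomp Require Import lra.
Import Order.TTheory GRing.Theory Num.Theory numFieldNormedType.Exports.
Local Open Scope classical_set_scope.
Local Open Scope ring_scope.

(** Reachability yields a minimum principle: [Tlow d <= d] off [A] and
    [0 <= d] on [A] force [0 <= d].  Applied to [h_n - h_(n+1)], on which
    [Tlow <= T_(n+1)], it shows that [h] is nonincreasing; it also gives the
    uniqueness of hitting solutions, so that [h_n] is determined by [T_n] and
    [h] is stationary as soon as [h_n = h_(n+1)].  By the pigeonhole principle
    two of [T_1, ..., T_(m+1)] coincide, hence so do the corresponding [h]'s
    and, by monotonicity, all those in between. *)

Section Coherence.
Context (R : realType) (X : finType) (T : (X -> R) -> X -> R).
Hypothesis T_coherent : coherent T.

Lemma coherent_lbound (f : X -> R) (c : R) (x : X) :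
  (forall y, c <= f y) -> c <= T f x.
Proof.
case: T_coherent => _ _ C3 cf; apply: le_trans (C3 f x).
by elim/big_ind: _ => // a b; rewrite le_min => -> ->.
Qed.

Lemma coherent0 (x : X) : T 0 x = 0.
Proof.
case: T_coherent => C1 _ _.
by have := C1 0 0 (lexx 0); rewrite !scale0r => ->.
Qed.

Lemma coherent_mono (f g : X -> R) (x : X) :
  (forall y, f y <= g y) -> T f x <= T g x.
Proof.
case: T_coherent => _ C2 _ fg.
have := C2 f (g - f) x; rewrite (addrC f) subrK; apply: le_trans.
rewrite -[leLHS]addr0 lerD2l; apply: coherent_lbound => y.
by rewrite subr_ge0.
Qed.

(** By C2, [T f] dominates [T (f + c) + T (- c)], and C3 gives [T (- c) >= - c]. *)
Lemma coherentD_cst_le (f : X -> R) (c : R) (x : X) :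
  T (f + cst c) x <= T f x + c.
Proof.
case: T_coherent => _ C2 _.
have := C2 (f + cst c) (cst (- c)) x.
have -> : f + cst c + cst (- c) = f.
  by apply/funext => y; rewrite !fctE addrK.
have : - c <= T (cst (- c)) x by apply: coherent_lbound.
rewrite !fctE; lra.
Qed.

Lemma coherent_iter_le (f u : X -> R) (n : nat) (x : X) :
  (forall y, T u y <= u y) -> (forall y, f y <= u y) -> iter n T f x <= u x.
Proof.
move=> Tu fu; elim: n x => [|n IHn] x //=.
exact: le_trans (coherent_mono _ _ _ IHn) (Tu x).
Qed.

(** At a negative minimum [d x], truncating, shifting and rescaling [d] yields [u] with [T u <= u]
    that dominates the indicator of [A]. All iterates at [x] are then at most [u x = 0], against
    reachability. *)
Lemma minimum_principle (A : set X) (d : X -> R) :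
    reachability A T -> (forall x, A x -> 0 <= d x) ->
    (forall x, (~` A) x -> T d x <= d x) ->
  forall x, 0 <= d x.
Proof.
move=> reach dA dAc x0.
case: (@arg_minP _ R X x0 predT d isT) => x _ dmin.
apply: le_trans (dmin x0 isT); rewrite leNgt; apply/negP => dx_lt0.
(* Truncation at 0 extends the inequality to all of [X]: on [A], [e] vanishes while
   [T e <= T 0 = 0]. *)
pose e y := Num.min (d y) 0.
have e_d y : e y <= d y by rewrite ge_min lexx.
have e_0 y : e y <= 0 by rewrite ge_min lexx orbT.
have Te y : T e y <= e y.
  have Te0 : T e y <= 0 by rewrite -(coherent0 y); apply: coherent_mono.
  rewrite le_min Te0 andbT; have [Ay|Ay] := pselect (A y).
    exact: le_trans Te0 (dA y Ay).
  exact: le_trans (coherent_mono _ _ _ e_d) (dAc y Ay).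
have c_gt0 : 0 < (- d x)^-1 by rewrite invr_gt0 oppr_gt0.
(* [u] is nonnegative, at least [1] on [A], and vanishes at the minimizer [x]. *)
pose u : X -> R := (- d x)^-1 *: (e + cst (- d x)).
have Tu y : T u y <= u y.
  case: T_coherent => C1 _ _; rewrite /u (C1 _ _ (ltW c_gt0)).
  rewrite !fctE; apply: ler_wpM2l; first exact: ltW.
  apply: le_trans (coherentD_cst_le _ _ _) _.
  by rewrite lerD2r.
have Au y : (\1_A : X -> R) y <= u y.
  rewrite /u !fctE indicE; have [/set_mem Ay|_] := boolP (y \in A).
    by rewrite /e min_r ?dA// add0r /GRing.scale/= mulVf// oppr_eq0 lt_eqF.
  apply: mulr_ge0; first exact: ltW.
  by rewrite subr_ge0 le_min dmin// ltW.
have nAx : (~` A) x by move=> /dA; rewrite leNgt dx_lt0.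
have [n _] := reach x nAx; apply/negP; rewrite -leNgt.
apply: le_trans (coherent_iter_le _ _ _ _ Tu Au) _.
by rewrite /u !fctE /e min_l ?(ltW dx_lt0)// subrr /GRing.scale/= mulr0.
Qed.

End Coherence.

Section HittingSystem.
Context (R : realType) (X : finType) (A : set X).
Implicit Types (T Tlow : (X -> R) -> X -> R) (h : X -> R).

Lemma solves_hitting_systemP T h :
  solves_hitting_system A T h <->
  (forall x, A x -> h x = 0) /\ (forall x, (~` A) x -> h x = 1 + T h x).
Proof.
split=> [hE|[hA hAc]].
  split=> x Ax; rewrite [in LHS]hE !fctE indicE.
    by rewrite memNset ?mul0r ?addr0//; apply.
  by rewrite mem_set// mul1r.
apply/funext => x; rewrite !fctE indicE; have [Ax|Ax] := pselect (A x).
  by rewrite memNset ?mul0r ?addr0 ?hA//; apply.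
by rewrite mem_set// mul1r hAc.
Qed.

Lemma dual_le Tlow TT T (f : X -> R) (x : X) :
  is_dual_representation Tlow TT -> TT T -> Tlow f x <= T f x.
Proof.
case=> _ _ _ TTP TlowE TT_T; rewrite TlowE; apply: ge_inf; last by exists T.
(* A real [inf] is a lower bound only of a set bounded below; C3 bounds every [S f x] by the same
   minimum. *)
exists (\big[Num.min/f x]_(y : X) f y) => _ [S /TTP[_ [_ _ C3]] <-].
exact: C3.
Qed.

(** The minimum principle applies to [g - h]: off [A], [Tlow (g - h) <= T g - T h <= (g - 1) - (h -
    1)]. *)
Lemma hitting_comparison Tlow T h g :
    coherent Tlow -> reachability A Tlow -> linear T ->
    (forall f x, Tlow f x <= T f x) -> solves_hitting_system A T h ->
    (forall x, A x -> 0 <= g x) -> (forall x, (~` A) x -> 1 + T g x <= g x) ->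
  forall x, h x <= g x.
Proof.
move=> Tcoh reach Tlin TlowT /solves_hitting_systemP[hA hAc] gA gAc x.
rewrite -subr_ge0 -[_ - _]/((g - h) x).
apply: (minimum_principle _ _ _ Tcoh A) => // {}x Ax.
  by rewrite !fctE hA// subr0 gA.
apply: le_trans (TlowT _ _) _.
have -> : T (g - h) = T g - T h.
  by have := Tlin (-1) h g; rewrite !scaleN1r [in LHS]addrC [in RHS]addrC.
rewrite !fctE (hAc _ Ax); move: (gAc _ Ax); lra.
Qed.

Lemma hitting_unique Tlow T h g :
    coherent Tlow -> reachability A Tlow -> linear T ->
    (forall f x, Tlow f x <= T f x) ->
    solves_hitting_system A T h -> solves_hitting_system A T g -> h = g.
Proof.
move=> Tcoh reach Tlin TlowT hS gS; apply/funext => x.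
have le_sol f f' : solves_hitting_system A T f ->
    solves_hitting_system A T f' -> f x <= f' x.
  move=> fS /solves_hitting_systemP[fA fAc].
  apply: (hitting_comparison Tlow T) => // y Ay; first by rewrite fA.
  by rewrite -fAc.
by apply/eqP; rewrite eq_le !le_sol.
Qed.

End HittingSystem.

(** Otherwise [u] would embed [m.+1] indices into a set of [m] elements. *)
Lemma card_pigeonhole {T : Type} (E : set T) (m : nat) (u : nat -> T) :
    (E #= `I_m)%card -> (forall i, E (u i)) ->
  exists i j, [/\ (i < j)%N, (j <= m)%N & u i = u j].
Proof.
move=> Em Eu; apply: contrapT => no_rep.
suff : (`I_m.+1 #<= `I_m)%card by rewrite card_le_II ltnn.
rewrite -(card_le_eqr Em).
suff uI : {in `I_m.+1 &, injective u}.
  rewrite -(card_le_eql (inj_card_eq uI)).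
  by apply: subset_card_le => _ [x _ <-].
move=> i j /set_mem/= im /set_mem/= jm uij.
case: (ltngtP i j) => // ij; case: no_rep.
  by exists i, j.
by exists j, i.
Qed.

Theorem corollary7 (R : realType) (X : finType) (A : set X)
    (A_neq0 : A !=set0) (A_strict : A `<` [set: X])
    (Tlow : (X -> R) -> X -> R)
    (Tlow_coherent : coherent Tlow)
    (Tlow_reach : reachability A Tlow)
    (TT : set ((X -> R) -> X -> R))
    (TT_dual : is_dual_representation Tlow TT)
    (m : nat) (m_gt0 : (0 < m)%N)
    (TT_extreme : (extreme_points TT #= `I_m)%card)
    (T_ : nat -> (X -> R) -> X -> R) (h : nat -> {ptws X -> R})
    (T1_extreme : extreme_points TT (T_ 1%N))
    (h_solves : forall n, (0 < n)%N -> solves_hitting_system A (T_ n) (h n))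
    (TS_extreme : forall n, (0 < n)%N -> extreme_points TT (T_ n.+1))
    (TS_attains : forall n, (0 < n)%N -> Tlow (h n) = T_ n.+1 (h n)) :
  exists hstar : {ptws X -> R}, h @ \oo --> hstar /\
    exists n : nat, (0 < n <= m)%N /\
      forall k : nat, (n <= k)%N -> h k = hstar.
Proof.
have T_ext n : extreme_points TT (T_ n.+1) by case: n => // n; exact: TS_extreme.
have TTn n : TT (T_ n.+1) by case: (T_ext n).
have T_lin n : linear (T_ n.+1) by case: TT_dual => _ _ _ + _ => /(_ _ (TTn n))[].
have Tlow_le n f x : Tlow f x <= T_ n.+1 f x by exact: dual_le TT_dual (TTn n).
have h_decr n x : h n.+2 x <= h n.+1 x.
  have /solves_hitting_systemP[hA hAc] := h_solves n.+1 isT.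
  (* [h n.+1] is a supersolution for [T_ n.+2], as [T_ n.+2 (h n.+1) = Tlow (h n.+1) <= T_ n.+1 (h
     n.+1)]. *)
  apply: (hitting_comparison _ _ A Tlow (T_ n.+2)) => // [|y Ay|y Ay].
  - exact: h_solves.
  - by rewrite hA.
  - by rewrite hAc// -TS_attains// lerD2l.
have h_le i j x : (i <= j)%N -> h j.+1 x <= h i.+1 x.
  elim: j => [|j IHj]; first by rewrite leqn0 => /eqP ->.
  rewrite leq_eqVlt => /predU1P[->//|/IHj]; exact: le_trans.
have h_stat n : h n.+1 = h n.+2 -> h n.+2 = h n.+3.
  move=> hE; apply: (hitting_unique _ _ A Tlow (T_ n.+3)) => //; last exact: h_solves.
  (* On the common value of [h n.+1] and [h n.+2], both [T_ n.+2] and [T_ n.+3] agree with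
     [Tlow]. *)
  rewrite /solves_hitting_system -TS_attains// -hE TS_attains// hE.
  exact: h_solves.
(* With the shift, the indices [0..m] run over [T_ 1, ..., T_ m.+1]. *)
have [i [j [ij jm Tij]]] := card_pigeonhole _ _ (fun n => T_ n.+1) TT_extreme T_ext.
have hij : h i.+1 = h j.+1.
  apply: (hitting_unique _ _ A Tlow (T_ i.+1)) => //; first exact: h_solves.
  by rewrite Tij; exact: h_solves.
(* Since [i < j], monotonicity gives [h i.+1 = h j.+1 <= h i.+2]. *)
have hi : h i.+1 = h i.+2.
  apply/funext => x; apply/eqP; rewrite eq_le h_decr andbT hij.
  exact: h_le.
have h_cst k : h (i + k).+1 = h i.+1 /\ h (i + k).+1 = h (i + k).+2.
  elim: k => [|k [IH1 IH2]]; first by rewrite addn0.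
  by rewrite addnS -IH2; split=> //; rewrite [in LHS]IH2; exact: h_stat.
have hk k : (i < k)%N -> h k = h i.+1.
  by case: k => // k; rewrite ltnS => /subnKC <-; case: (h_cst (k - i)%N).
(* The bound [i.+1 <= m] comes from [i < j <= m]. *)
exists (h i.+1); split; last by exists i.+1; rewrite ltn0Sn (leq_trans ij jm).
by apply: cvg_near_cst; exists i.+1 => // k /hk.
Qed.
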